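(* Let $G=(V,E)$ be a finite simple undirected graph whose node set is partitioned into a set $\mathcal{C}$ of (nonempty) categories, let $A,B\in\mathcal{C}$ with $A\neq B$, and let $S$ be a uniform independence sample of size $n$ from $V$. Then the induced-subgraph estimator of the category edge weight $$\widehat{\mathrm{w}}(A,B)=\frac{\sum_{a\in S_A}\sum_{b\in S_B}1_{\{\{a,b\}\in E\}}}{|S_A|\cdot|S_B|}$$ is consistent for $\mathrm{w}(A,B)=\dfrac{|E_{A,B}|}{|A|\cdot|B|}$, i.e. $\widehat{\mathrm{w}}(A,B)\to\mathrm{w}(A,B)$ in probability as $n\to\infty$.
   Context: $E_{A,B}=\{\{u,v\}\in E: u\in A,\ v\in B\}$ is the edge-cut between categories $A$ and $B$. Uniform independence sampling (UIS): $X_1,X_2,\dots$ are i.i.d. random nodes uniformly distributed on $V$ (sampling with replacement), and $S$ is the multiset $\{X_1,\dots,X_n\}$; all sums over and sizes of sub-multisets of $S$ count multiplicity. For a category $C$, $S_C=\{v\in S: v\in C\}$ is the sub-multiset of samples in $C$. Any ratio whose denominator is zero is assigned the value $0$. $G$ is fixed. *)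

(* Defs.v *)
From HB Require Import structures.
From mathcomp Require Import all_boot all_order all_algebra.
From mathcomp Require Import finmap.
From mathcomp Require Import all_classical all_reals all_analysis.

Set Implicit Arguments.
Unset Strict Implicit.
Unset Printing Implicit Defensive.

Import Order.TTheory GRing.Theory Num.Theory.
Import numFieldNormedType.Exports.

Local Open Scope classical_set_scope.
Local Open Scope ring_scope.

(* A finite simple undirected graph on V is its set of edges, each edge being
   an unordered pair of distinct nodes. *)
Definition simple_graph (V : finType) (E : {set {set V}}) : Prop :=
  forall x : {set V}, x \in E -> #|x| = 2%N.

Definition edge_cut (V : finType) (E : {set {set V}}) (A B : {set V}) :
    {set {set V}} :=
  [set x in E | [exists u in A, [exists v in B, x == [set u; v]%SET]]]%SET.

(* Division by 0 gives 0 in a field, here and in [edge_weight_estimator]. *)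
Definition edge_weight (R : realType) (V : finType) (E : {set {set V}})
    (A B : {set V}) : R :=
  #|edge_cut E A B|%:R / (#|A|%:R * #|B|%:R).

(* A multiset of nodes is represented by a sequence, in which the same node may
   occur several times. *)
Definition subsample (V : finType) (S : seq V) (C : {set V}) : seq V :=
  [seq v <- S | v \in C].

Definition edge_weight_estimator (R : realType) (V : finType)
    (E : {set {set V}}) (A B : {set V}) (S : seq V) : R :=
  (\sum_(a <- subsample S A) \sum_(b <- subsample S B)
      ([set a; b]%SET \in E)%:R)
  / ((size (subsample S A))%:R * (size (subsample S B))%:R).

Section Sampling.
Context (d : measure_display) (Omega : measurableType d) (R : realType).
Variable P : probability Omega R.

(* The finite type V carries the discrete sigma-algebra. *)
Definition random_node (V : finType) (X : Omega -> V) : Prop :=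
  forall B : set V, measurable (X @^-1` B).

Definition mutually_independent (V : finType) (X : nat -> Omega -> V) : Prop :=
  forall (J : {fset nat}) (B : nat -> set V),
    P (\bigcap_(i in [set` J]) (X i @^-1` B i)) =
    (\prod_(i <- J) P (X i @^-1` B i))%E.

Definition uniform_on_nodes (V : finType) (X : Omega -> V) : Prop :=
  forall v : V, P (X @^-1` [set v]) = (#|V|%:R^-1)%:E.

Definition uniform_independence_sampling (V : finType)
    (X : nat -> Omega -> V) : Prop :=
  [/\ forall i, random_node (X i),
      mutually_independent X
    & forall i, uniform_on_nodes (X i)].

(* The draws are indexed from 0, so the sample of size n is X_0, ..., X_(n-1). *)
Definition sample (V : finType) (X : nat -> Omega -> V) (n : nat)
    (w : Omega) : seq V :=
  [seq X i w | i <- iota 0 n].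

Definition cvg_in_probability (Y : nat -> Omega -> R) (l : R) : Prop :=
  forall eps : R, 0 < eps ->
    P [set w | eps < `|Y n w - l|] @[n --> \oo] --> 0%E.

End Sampling.

(* Main.v *)
(* The estimator is a ratio of polynomials in the empirical frequencies of the
   nodes: dividing every multiplicity by n scales numerator and denominator by
   the same factor n^-2.  At the uniform frequency vector 1/#|V| this ratio
   equals the edge weight, and it is continuous there because A and B are
   nonempty.  Each frequency converges in probability to 1/#|V| by Chebyshev's
   inequality (distinct draws are uncorrelated), and the continuous mapping
   principle transfers the convergence to the estimator. *)

Require Import Defs.
From mathcomp Require Import all_boot all_order all_algebra.
From mathcomp Require Import finmap.
From mathcomp Require Import all_classical all_reals all_analysis.
From mathcomp Require Import measurable_realfun.

Set Implicit Arguments.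
Unset Strict Implicit.
Unset Printing Implicit Defensive.

Import Order.TTheory GRing.Theory Num.Theory.
Import numFieldNormedType.Exports.

Local Open Scope classical_set_scope.
Local Open Scope ring_scope.

(** * Weak law for pairwise independent events of equal probability *)

Section WeakLaw.
Context (d : measure_display) (Omega : measurableType d) (R : realType).
Variable P : probability Omega R.

Lemma measurable_deviation_lt (Y : Omega -> R) (l eps : R) :
  measurable_fun setT Y -> measurable [set w | eps < `|Y w - l|].
Proof.
move=> mY; have mD : measurable_fun setT (fun w => `|Y w - l|).
  by apply: measurableT_comp => //; exact: measurable_funB.
rewrite (_ : [set _ | _] = setT `&` (fun w => `|Y w - l|) @^-1` `]eps, +oo[).
  exact: mD.
by apply/seteqP; split => w /=; rewrite in_itv/= andbT => // -[].
Qed.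

Lemma measurable_deviation_le (Y : Omega -> R) (l eps : R) :
  measurable_fun setT Y -> measurable [set w | eps <= `|Y w - l|].
Proof.
move=> mY; have mD : measurable_fun setT (fun w => `|Y w - l|).
  by apply: measurableT_comp => //; exact: measurable_funB.
rewrite (_ : [set _ | _] = setT `&` (fun w => `|Y w - l|) @^-1` `[eps, +oo[).
  exact: mD.
by apply/seteqP; split => w /=; rewrite in_itv/= andbT => // -[].
Qed.

Lemma Lfun_indic (A : set Omega) (r : R) : 0 < r -> measurable A ->
  (\1_A : Omega -> R) \in Lfun P r%:E.
Proof.
move=> r0 mA; rewrite inE; apply/andP; split; rewrite inE /=.
  exact: measurable_indic.
rewrite /finite_norm unlock poweR_lty//.
(* Since [r] is nonzero, the [r]-th power of an indicator is the indicator itself. *)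
rewrite (eq_integral (fun x => (\1_A x)%:E)) => [|x _].
  by rewrite integral_indic// setIT (le_lt_trans (probability_le1 _ _)) ?ltry.
by rewrite /= indicE; case: (x \in A);
  rewrite ?normr1 ?normr0 ?powR1 ?powR0 ?gt_eqF.
Qed.

Lemma covariance_indic (A B : set Omega) : measurable A -> measurable B ->
  covariance P (\1_A) (\1_B) = (P (A `&` B) - P A * P B)%E.
Proof.
move=> mA mB.
have L1 C : measurable C -> (\1_C : Omega -> R) \in Lfun P 1.
  by apply: Lfun_indic.
have mAB := measurableI _ _ mA mB.
have E : (\1_A * \1_B)%R = \1_(A `&` B) :> (Omega -> R) by rewrite indicI.
by rewrite covarianceE ?E ?expectation_indic ?L1.
Qed.

Variables (A : nat -> set Omega) (p : R).
Hypotheses (mA : forall i, measurable (A i)) (PA : forall i, P (A i) = p%:E).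
Hypothesis PAI : forall i j, i != j -> P (A i `&` A j) = (p * p)%:E.

(** Summing bundled measurable functions yields a random variable to which [chebyshev] applies
    directly. *)
Definition occurrences (n : nat) : {mfun Omega >-> R} :=
  \sum_(i < n) indic_mfun (A i) (mA i).

Lemma occurrencesS n :
  (occurrences n.+1 : Omega -> R) = (occurrences n \+ \1_(A n))%R.
Proof. by rewrite /occurrences big_ord_recr. Qed.

Lemma occurrences0 : (occurrences 0 : Omega -> R) = cst 0.
Proof. by rewrite /occurrences big_ord0. Qed.

Lemma Lfun_occurrences n : (occurrences n : Omega -> R) \in Lfun P 2%:E.
Proof.
elim: n => [|n IHn]; first by rewrite occurrences0 Lfun_cst.
by rewrite occurrencesS rpredD//= ?lee1n// => _; exact: Lfun_indic.
Qed.

Lemma expectation_occurrences n : ('E_P[occurrences n] = (n%:R * p)%:E)%E.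
Proof.
have PT : P setT \is a fin_num := fin_num_measure P _ measurableT.
elim: n => [|n IHn]; first by rewrite occurrences0 expectation_cst mul0r.
rewrite occurrencesS expectationD ?(Lfun_subset12 PT) ?Lfun_occurrences//.
  by rewrite IHn expectation_indic// PA -EFinD -[n.+1]addn1 natrD mulrDl mul1r.
exact: Lfun_indic.
Qed.

(** By additivity only covariances of [A i] and [A m] with [i < m] arise, each equal to
    [p * p - p * p]. *)
Lemma covariance_occurrences n m : (n <= m)%N ->
  covariance P (occurrences n) (\1_(A m)) = 0.
Proof.
elim: n => [|n IHn] nm; first by rewrite occurrences0 covariance_cst_l.
rewrite occurrencesS covarianceDl ?Lfun_occurrences ?Lfun_indic//.
rewrite IHn 1?ltnW// add0e covariance_indic// PAI ?ltn_eqF//.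
by rewrite !PA -EFinM subee.
Qed.

(** Each new event adds only its own variance $p - p^2 \le 1$, as the cross term vanishes. Growth
    linear in [n] is enough against the factor $n^{-2}$ from Chebyshev. *)
Lemma variance_occurrences_le n : ('V_P[occurrences n] <= n%:R%:E)%E.
Proof.
elim: n => [|n IHn]; first by rewrite occurrences0 variance_cst.
rewrite occurrencesS varianceD ?Lfun_occurrences ?Lfun_indic//.
rewrite covariance_occurrences// mule0 adde0 -[n.+1]addn1 natrD EFinD.
apply: leeD => //; rewrite /variance covariance_indic// setIid.
rewrite (le_trans _ (probability_le1 P (mA n)))// PA lee_fin.
by rewrite gerBl -expr2 sqr_ge0.
Qed.

Lemma weak_law_occurrences :
  cvg_in_probability P (fun n w => occurrences n w / n%:R) p.
Proof.
move=> eps eps0.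
(* The upper bound is Chebyshev's $n / (\varepsilon n)^2$ after cancellation. *)
apply: (@squeeze_cvge _ _ _ _ (cst 0%E) _
  (fun n => (eps ^- 2 * n%:R^-1)%:E)); last 2 first.
- exact: cvg_cst.
- have -> : 0%E = (eps ^- 2 * 0)%:E :> \bar R by rewrite mulr0.
  apply: cvg_EFin; first by near=> n.
  apply: (@cvgMl_tmp R).
  by rewrite -cvg_shiftS; exact: cvg_harmonic.
near=> n; rewrite measure_ge0 /=.
have n0 : 0 < n%:R :> R by rewrite ltr0n; near: n; exists 1%N.
have en0 : 0 < eps * n%:R by rewrite mulr_gt0.
(* A deviation of the frequency by [eps] is a deviation of the count from its mean [n * p] by
   [eps * n]. *)
have dev w : (eps < `|occurrences n w / n%:R - p|) =
    (eps * n%:R < `|occurrences n w - fine 'E_P[occurrences n]%E|).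
  rewrite expectation_occurrences/= -ltr_pdivlMr// -{3}(gtr0_norm n0).
  by rewrite -normf_div mulrBl (mulrC n%:R p) mulfK ?gt_eqF.
(* Chebyshev bounds the event with a non-strict inequality, which contains the strict one. *)
apply: (@le_trans _ _ (P [set w | eps * n%:R <=
    `|occurrences n w - fine 'E_P[occurrences n]%E|])).
  apply: le_measure; rewrite ?inE.
  - by under eq_set do rewrite dev; exact: measurable_deviation_lt.
  - exact: measurable_deviation_le.
  - by move=> w /=; rewrite dev => /ltW.
rewrite (le_trans (@chebyshev _ _ _ P (occurrences n) _ en0))//.
rewrite (le_trans (lee_wpmul2l _ (variance_occurrences_le n))) ?lee_fin//.
  by rewrite invr_ge0 exprn_ge0 ?ltW.
have n2 : n%:R ^- 2 * n%:R = n%:R^-1 :> R.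
  by rewrite expr2 invfM -mulrA mulVf ?mulr1 ?gt_eqF.
by rewrite exprMn invfM -mulrA n2.
Unshelve. all: by end_near.
Qed.
End WeakLaw.

(** * Continuous mapping for a constant limit *)

Section ContinuousMapping.
Context (d : measure_display) (Omega : measurableType d) (R : realType).
Variable P : probability Omega R.

Lemma measure_bigsetU_le (I : Type) (r : seq I) (F : I -> set Omega) :
  (forall i, measurable (F i)) ->
  (P (\big[setU/set0]_(i <- r) F i) <= \sum_(i <- r) P (F i))%E.
Proof.
move=> mF; elim: r => [|i r IHr]; first by rewrite !big_nil measure0.
rewrite !big_cons (le_trans (measureU2 _ _ _))//; first last.
- exact: leeD.
- exact: bigsetU_measurable.
Qed.

(** If [g (Y n w)] is far from [g y], then some coordinate of [Y n w] is far from that of [y]. A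
    union bound over the [m] coordinates concludes. *)
Lemma cvg_in_probability_continuous (m : nat) (Y : nat -> Omega -> 'rV[R]_m)
    (y : 'rV[R]_m) (g : 'rV[R]_m -> R) :
  (forall n j, measurable_fun setT (fun w => Y n w 0 j)) ->
  (forall n, measurable_fun setT (g \o Y n)) ->
  {for y, continuous g} ->
  (forall j, cvg_in_probability P (fun n w => Y n w 0 j) (y 0 j)) ->
  cvg_in_probability P (fun n w => g (Y n w)) (g y).
Proof.
move=> mY mgY cg cvY eps eps0.
have [delta /= delta0 gdelta] : nbhs_ball y [set z | `|g z - g y| <= eps].
  by apply/nbhs_ballP; move/cvgrPdistC_le: cg; apply.
(* Outside every [F n j] the distances are only at most the threshold, while the ball is strict;
   halving [delta] restores strictness. *)
have delta20 : 0 < delta / 2 by rewrite divr_gt0.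
pose F n j := [set w | delta / 2 < `|Y n w 0 j - y 0 j|].
have mF n j : measurable (F n j) by exact: measurable_deviation_lt.
apply: (@squeeze_cvge _ _ _ _ (cst 0%E) _ (fun n => \sum_(j < m) P (F n j))%E).
- near=> n; rewrite measure_ge0 /= (le_trans _ (measure_bigsetU_le _ (mF n)))//.
  apply: le_measure; rewrite ?inE.
  + exact: measurable_deviation_lt (mgY n).
  + exact: bigsetU_measurable.
  + move=> w /= gw; apply: contrapT => nF; move: gw; apply/negP.
    rewrite -leNgt; apply: gdelta; split=> // i j; rewrite (ord1 i).
    rewrite /ball/= distrC.
    rewrite (@le_lt_trans _ _ (delta / 2)) ?gtr_pMr ?invf_lt1 ?ltr1n//.
    rewrite leNgt; apply/negP => Fj; apply: nF.
    by rewrite -bigcup_seq; exists j; rewrite /= ?mem_index_enum.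
- exact: cvg_cst.
- have sum0 : (\sum_(j < m) 0 = 0 :> \bar R)%E by rewrite big1.
  rewrite -[X in _ --> X]sum0.
  apply: cvg_nnesum => // j _; [near=> n; exact: measure_ge0 | exact: cvY].
Unshelve. all: end_near.
Qed.
End ContinuousMapping.

(** * The estimator as a function of node weights *)

Section PlugIn.
Context (R : realType) (V : finType) (E : {set {set V}}) (A B : {set V}).

(** The edge density between [A] and [B] when node [v] has weight [f v]. Multiplicities give the
    estimator, constant weights the true edge weight. *)
Definition plug_in_weight (f : V -> R) : R :=
  (\sum_(a in A) \sum_(b in B) f a * f b * ([set a; b]%SET \in E)%:R)
  / ((\sum_(a in A) f a) * (\sum_(b in B) f b)).

Lemma plug_in_weightZ (c : R) (f : V -> R) : c != 0 ->
  plug_in_weight (fun v => c * f v) = plug_in_weight f.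
Proof.
move=> c0.
have sumZ (C : {set V}) : \sum_(v in C) c * f v = c * \sum_(v in C) f v.
  by rewrite mulr_sumr.
rewrite /plug_in_weight !sumZ mulrACA.
rewrite (_ : \sum_(a in A) \sum_(b in B) _ = (c * c) * \sum_(a in A)
    \sum_(b in B) f a * f b * ([set a; b]%SET \in E)%:R).
  by rewrite -mulf_div divff ?mul1r ?mulf_neq0.
rewrite mulr_sumr; apply: eq_bigr => a _; rewrite mulr_sumr.
by apply: eq_bigr => b _; rewrite mulrACA -[LHS]mulrA.
Qed.

Lemma big_subsample (C : {set V}) (s : seq V) (F : V -> R) :
  \sum_(v <- subsample s C) F v = \sum_(v in C) (count_mem v s)%:R * F v.
Proof.
rewrite /subsample big_filter; elim: s => [|x s IHs].
  by rewrite big_nil big1// => v _; rewrite mul0r.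
rewrite big_cons IHs /=; under [RHS]eq_bigr do rewrite natrD mulrDl.
rewrite big_split /=; case: ifPn => xC.
  (* The head [x] adds one unit to the multiplicity of the single node [v = x]. *)
  congr (_ + _); rewrite (bigD1 x)//= eqxx mul1r big1 ?addr0// => v /andP[_ vx].
  by rewrite eq_sym (negbTE vx) mul0r.
rewrite [X in _ = X + _]big1 ?add0r// => v vC.
by rewrite (_ : (x == v) = false) ?mul0r//; apply: contraNF xC => /eqP ->.
Qed.

Lemma edge_weight_estimatorE (s : seq V) :
  edge_weight_estimator R E A B s =
  plug_in_weight (fun v => (count_mem v s)%:R).
Proof.
have sizeE C : (size (subsample s C))%:R =
    \sum_(v in C) (count_mem v s)%:R :> R.
  rewrite -sum1_size natr_sum big_subsample.
  by apply: eq_bigr => v _; rewrite mulr1.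
rewrite /edge_weight_estimator /plug_in_weight !sizeE big_subsample.
congr (_ / _); apply: eq_bigr => a _; rewrite big_subsample mulr_sumr.
by apply: eq_bigr => b _; rewrite mulrA.
Qed.

(* For [n = 0] both sides are [0 / 0 = 0]. *)
Lemma edge_weight_estimator_freq (n : nat) (s : seq V) : size s = n ->
  edge_weight_estimator R E A B s =
  plug_in_weight (fun v => (count_mem v s)%:R / n%:R).
Proof.
have fE (g : V -> R) : (fun v => g v / n%:R) = (fun v => n%:R^-1 * g v).
  by apply/funext => v; rewrite mulrC.
rewrite fE edge_weight_estimatorE; have [->|n0] := eqVneq n 0%N.
  move=> /size0nil ->; rewrite invr0.
  by congr plug_in_weight; apply/funext => v; rewrite mul0r.
by move=> _; rewrite plug_in_weightZ// invr_eq0 pnatr_eq0.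
Qed.

Hypothesis disjAB : {in A, forall v, v \notin B}.

(** As [A] and [B] are disjoint, a cut edge comes from exactly one pair in [A * B], so the cut is an
    injective image of the adjacent pairs. *)
Lemma card_edge_cut : #|edge_cut E A B|%:R =
  \sum_(a in A) \sum_(b in B) ([set a; b]%SET \in E)%:R :> R.
Proof.
pose pair (p : V * V) := [set p.1; p.2]%SET.
have -> : edge_cut E A B =
    [set pair p | p in finset.setX A B & pair p \in E]%SET.
  apply/setP => x; rewrite inE; apply/idP/imsetP.
    case/andP => xE /exists_inP[u uA /exists_inP[v vB /eqP xuv]].
    by exists (u, v); rewrite // inE finset.in_setX uA vB/= /pair/= -xuv.
  case=> -[u v]; rewrite inE finset.in_setX /= => /andP[/andP[uA vB] uvE] ->.
  rewrite uvE/=; apply/exists_inP; exists u => //.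
  by apply/exists_inP; exists v.
rewrite card_in_imset.
  rewrite -sum1_card natr_sum pair_big /= big_mkcond [RHS]big_mkcond /=.
  apply: eq_bigr => -[a b] _; rewrite inE finset.in_setX /pair /=.
  by case: (a \in A); case: (b \in B) => //=; case: (_ \in E).
move=> [a b] [a' b']; rewrite !inE /= => /andP[/andP[aA bB] _].
move=> /andP[/andP[a'A b'B] _] /setP eqab.
have neq u v : u \in A -> v \in B -> (u == v) = false.
  by move=> uA vB; apply: contraTF vB => /eqP <-; exact: disjAB.
(* Disjointness rules out the crossed matches [a = b'] and [b = a']. *)
have := eqab a; have := eqab b; rewrite /pair !inE/= !eqxx orbT /=.
rewrite (neq a b')// orbF (eq_sym b) (neq a' b)//= => /esym/eqP -> /esym/eqP ->.
by [].
Qed.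

Lemma plug_in_weight_cst (c : R) : c != 0 ->
  plug_in_weight (fun=> c) = edge_weight R E A B.
Proof.
move=> c0; rewrite (_ : (fun=> c) = (fun v : V => c * 1)); last first.
  by apply/funext => v; rewrite mulr1.
rewrite plug_in_weightZ// /plug_in_weight /edge_weight card_edge_cut.
rewrite !sumr_const; congr (_ / _); apply: eq_bigr => a _.
by apply: eq_bigr => b _; rewrite !mul1r.
Qed.

End PlugIn.

Lemma cvg_plug_in_weight (R : realType) (V : finType) (E : {set {set V}})
    (A B : {set V}) (T : Type) (F : set_system T) (FF : Filter F)
    (f : T -> V -> R) (l : V -> R) :
  \sum_(a in A) l a != 0 -> \sum_(b in B) l b != 0 ->
  (forall v, f t v @[t --> F] --> l v) ->
  plug_in_weight E A B (f t) @[t --> F] --> plug_in_weight E A B l.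
Proof.
move=> lA0 lB0 fl.
have sums (C : {set V}) : \sum_(v in C) f t v @[t --> F] --> \sum_(v in C) l v.
  by apply: cvg_big => [|v _]; [exact: add_continuous|exact: fl].
apply: (@cvgM R); last by apply: cvgV; [rewrite mulf_neq0|apply: (@cvgM R)].
apply: cvg_big => [|a _]; first exact: add_continuous.
apply: cvg_big => [|b _]; first exact: add_continuous.
by apply: (@cvgM R); [apply: (@cvgM R)|exact: cvg_cst].
Qed.

(** * Measurability and node frequencies of the sample *)

Section Sample.
Context (d : measure_display) (Omega : measurableType d) (R : realType).
Context (P : probability Omega R) (V : finType) (X : nat -> Omega -> V).
Hypothesis mX : forall i, random_node (X i).

Lemma sampleS n w : sample X n.+1 w = rcons (sample X n w) (X n w).
Proof. by rewrite /sample -addn1 iotaD map_cat /= cats1. Qed.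

(** Induction on [n], splitting over the finitely many values [v] of the last draw. [Q] is general
    because the step replaces it by the property [Q (rcons s v)] of the earlier draws. *)
Lemma measurable_sample n (Q : set (seq V)) :
  measurable [set w | Q (sample X n w)].
Proof.
elim: n Q => [|n IHn] Q.
  rewrite (_ : [set _ | _] = if `[< Q [::] >] then setT else set0).
    by case: ifPn.
  by apply/seteqP; split => w /=; case: asboolP.
rewrite (_ : [set _ | _] = \big[setU/set0]_(v : V)
    (X n @^-1` [set v] `&` [set w | Q (rcons (sample X n w) v)])).
  apply: bigsetU_measurable => v _; apply: measurableI; first exact: mX.
  exact: (IHn [set s | Q (rcons s v)]).
rewrite -bigcup_seq; apply/seteqP; split => w /=.
  by rewrite sampleS => Qw; exists (X n w); rewrite /= ?mem_index_enum.
by move=> [v _ [/= <-]]; rewrite sampleS.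
Qed.

Lemma measurable_fun_sample n (F : seq V -> R) :
  measurable_fun setT (fun w => F (sample X n w)).
Proof.
by move=> _ U _; rewrite setTI; exact: (measurable_sample n (F @^-1` U)).
Qed.

Lemma occurrences_sample v n w :
  occurrences R (fun i => mX i [set v]) n w =
  (count_mem v (sample X n w))%:R.
Proof.
elim: n => [|n IHn]; first by rewrite occurrences0.
rewrite sampleS -cats1 count_cat natrD occurrencesS /= IHn addn0.
congr (_ + (nat_of_bool _)%:R).
by apply/idP/eqP; rewrite inE.
Qed.

Lemma weak_law_sample (p : R) v : mutually_independent P X ->
  (forall i, P (X i @^-1` [set v]) = p%:E) ->
  cvg_in_probability P
    (fun n w => (count_mem v (sample X n w))%:R / n%:R) p.
Proof.
move=> iX PX.
rewrite (_ : (fun n w => _) = fun n w => occurrences R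
    (fun i => mX i [set v]) n w / n%:R); last first.
  by apply/funext => n; apply/funext => w; rewrite occurrences_sample.
apply: weak_law_occurrences => // i j ij.
(* Pairwise independence is mutual independence on the index set of two distinct draws. *)
have := iX [fset i; j]%fset (fun=> [set v]).
rewrite big_fsetU1 ?inE//= big_seq_fset1 !PX -EFinM => <-; congr (P _).
apply/seteqP; split => w.
  by move=> [wi wj] k /=; rewrite !inE => /orP[] /eqP ->.
by move=> Xw; split; apply: Xw; rewrite /= !inE eqxx ?orbT.
Qed.

End Sample.

Theorem mainTheorem3
  (V : finType) (E : {set {set V}}) (hE : simple_graph E)
  (Cs : {set {set V}}) (hCs : finset.partition Cs [set: V]%SET)
  (A B : {set V}) (hA : A \in Cs) (hB : B \in Cs) (hAB : A != B)
  (R : realType) (d : measure_display) (Omega : measurableType d)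
  (P : probability Omega R)
  (X : nat -> Omega -> V) (hX : uniform_independence_sampling P X) :
  cvg_in_probability P
    (fun (n : nat) (w : Omega) => edge_weight_estimator R E A B (sample X n w))
    (edge_weight R E A B).
Proof.
case: hX => mX iX uX.
have [_ trivCs Cs0] := and3P hCs.
have disjAB : {in A, forall v, v \notin B}.
  move=> v vA; have disj := finset.trivIsetP trivCs _ _ hA hB hAB.
  by rewrite (fintype.disjointFr disj vA).
have card_neq0 C : C \in Cs -> #|C|%:R != 0 :> R.
  move=> CCs; rewrite pnatr_eq0 cards_eq0.
  by apply: contraNneq Cs0 => <-.
(* An empty [V] would force the category [A] to be empty. *)
have V0 : #|V|%:R^-1 != 0 :> R.
  rewrite invr_eq0; apply: contraNneq (card_neq0 _ hA) => /eqP.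
  by rewrite !pnatr_eq0 -!leqn0 => /(leq_trans (max_card _)).
(* Functions on [V] are coded as row vectors through the enumeration of [V], to fit the continuous
   mapping lemma. *)
pose freq n w : 'rV[R]_#|V| :=
  \row_j ((count_mem (enum_val j) (sample X n w))%:R / n%:R).
pose y : 'rV[R]_#|V| := const_mx #|V|%:R^-1.
pose g (z : 'rV[R]_#|V|) := plug_in_weight E A B (fun v => z 0 (enum_rank v)).
have gfreq n w : edge_weight_estimator R E A B (sample X n w) = g (freq n w).
  rewrite (@edge_weight_estimator_freq _ _ _ _ _ n); last first.
    by rewrite size_map size_iota.
  by congr plug_in_weight; apply/funext => v; rewrite mxE enum_rankK.
have gy : edge_weight R E A B = g y.
  rewrite -(plug_in_weight_cst _ disjAB V0).
  by congr plug_in_weight; apply/funext => v; rewrite mxE.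
under eq_fun do under eq_fun do rewrite gfreq.
rewrite gy; apply: cvg_in_probability_continuous.
- move=> n j; under eq_fun do rewrite mxE.
  exact: (measurable_fun_sample mX n (fun s => (count_mem _ s)%:R / n%:R)).
- move=> n; rewrite (_ : g \o freq n =
      fun w => edge_weight_estimator R E A B (sample X n w)).
    exact: measurable_fun_sample.
  by apply/funext => w; rewrite gfreq.
(* At the uniform vector this sum is $|C| / |V|$, so the denominator of [g] does not vanish at
   [y]. *)
- have sum0 C : C \in Cs -> \sum_(v in C) y 0 (enum_rank v) != 0.
    move=> CCs; under eq_bigr do rewrite mxE.
    by rewrite sumr_const mulrn_eq0 negb_or -(pnatr_eq0 R) card_neq0 ?V0.
  apply: (@cvg_plug_in_weight _ _ E A B _ _ (nbhs_filter y)
    (fun (z : 'rV[R]_#|V|) v => z 0 (enum_rank v)) _ (sum0 A hA) (sum0 B hB)).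
  move=> v.
  exact: coord_continuous.
- move=> j; rewrite mxE.
  under eq_fun do under eq_fun do rewrite mxE.
  exact: (weak_law_sample mX iX (fun i => uX i _)).
Qed.
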